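(* Let $G$ be a connected graph with $n$ vertices and $m$ edges, let $T$ be a spanning tree of $G$, and let $\beta'$ be the matching number of $T$. (i) If $0\leq \alpha< \frac{1}{2}$, then $$S_k(A_{\alpha}(G))\leq \begin{cases} \alpha(n+2k-2)+(1-2\alpha)\sqrt{k(n-1)}+m-n+1, & \text{if } 1\leq k \leq \beta';\\ \alpha(n+2k-2)+(1-2\alpha)\sqrt{\beta' (n-1)}+m-n+1, & \text{if } \beta'< k \leq n-\beta';\\ \alpha(n+2k-2)+(1-2\alpha)\sqrt{(n-k)(n-1)}+m-n+1, & \text{if } n-\beta'< k \leq n. \end{cases}$$ (ii) If $\frac{1}{2}\leq \alpha< 1$, then $S_k(A_{\alpha}(G))\leq \alpha(2k+2m-n)$ for $2\leq k \leq n$.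
   Context: All graphs are simple and undirected. $A_{\alpha}(G)=\alpha D(G)+(1-\alpha)A(G)$, where $A(G)$ is the adjacency matrix and $D(G)$ the diagonal degree matrix. For a real symmetric matrix $M$ with eigenvalues $\lambda_1(M)\geq\cdots\geq\lambda_n(M)$, $S_k(M)=\sum_{i=1}^k\lambda_i(M)$. The matching number is the maximum size of a matching. *)

(* Defs.v *)
From HB Require Import structures.
From mathcomp Require Import all_boot all_order all_algebra.
From mathcomp Require Import reals.
Set Implicit Arguments. Unset Strict Implicit. Unset Printing Implicit Defensive.
Import Order.TTheory GRing.Theory Num.Theory.
Local Open Scope ring_scope.

Definition simple_graph (n : nat) (e : rel 'I_n) : Prop :=
  symmetric e /\ irreflexive e.

Definition connected_graph (n : nat) (e : rel 'I_n) : Prop :=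
  forall i j : 'I_n, connect e i j.

Definition num_edges (n : nat) (e : rel 'I_n) : nat :=
  #|[set p : 'I_n * 'I_n | (p.1 < p.2)%N && e p.1 p.2]|.

Definition degree (n : nat) (e : rel 'I_n) (i : 'I_n) : nat :=
  #|[set j : 'I_n | e i j]|.

Definition acyclic (n : nat) (t : rel 'I_n) : Prop :=
  forall p : seq 'I_n, (3 <= size p)%N -> uniq p -> ~~ cycle t p.

Definition subgraph (n : nat) (t e : rel 'I_n) : Prop :=
  forall i j, t i j -> e i j.

Definition spanning_tree (n : nat) (e t : rel 'I_n) : Prop :=
  simple_graph t /\ subgraph t e /\ connected_graph t /\ acyclic t.

Definition is_matching (n : nat) (t : rel 'I_n) (M : {set 'I_n * 'I_n}) : bool :=
  [forall p in M, (p.1 < p.2)%N && t p.1 p.2] &&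
  [forall p in M, forall q in M, (p != q) ==>
     [&& p.1 != q.1, p.1 != q.2, p.2 != q.1 & p.2 != q.2]].

Definition matching_number (n : nat) (t : rel 'I_n) : nat :=
  \max_(M : {set 'I_n * 'I_n} | is_matching t M) #|M|.

Definition adjacency_mx (R : realType) (n : nat) (e : rel 'I_n) : 'M[R]_n :=
  \matrix_(i, j) (e i j)%:R.

Definition degree_mx (R : realType) (n : nat) (e : rel 'I_n) : 'M[R]_n :=
  diag_mx (\row_i (degree e i)%:R).

Definition A_alpha (R : realType) (n : nat) (e : rel 'I_n) (alpha : R) : 'M[R]_n :=
  alpha *: degree_mx R e + (1 - alpha) *: adjacency_mx R e.

(* s is the list of eigenvalues of M (with multiplicity) in non-increasing
   order: lambda_1 >= ... >= lambda_n, i.e. the characteristic polynomial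
   splits as prod (X - lambda_i). For real symmetric M such s exists and
   is unique. *)
Definition eigenvalues_desc (R : realType) (n : nat) (M : 'M[R]_n) (s : seq R) : Prop :=
  sorted (fun x y : R => y <= x) s /\
  char_poly M = \prod_(x <- s) ('X - x%:P).

Definition S_k (R : realType) (s : seq R) (k : nat) : R :=
  \sum_(i < k) s`_i.

(* Main.v *)
Require Import Defs.
From HB Require Import structures.
From mathcomp Require Import all_boot all_order all_algebra.
From mathcomp Require Import reals.
From mathcomp Require Import perm spectral complex ring lra zify.
Import Order.TTheory GRing.Theory Num.Theory.
Local Open Scope ring_scope.

(** Let X be the orthogonal projection onto k eigenvectors of
    A_alpha = alpha D + (1 - alpha) A belonging to the first k eigenvalues, so
    that S_k = tr (A_alpha X); every bound is a bound on tr (_ X) that holds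
    for all projections X of rank k.

    Write Q = D + A. If mu is an eigenvalue of Q with unit eigenvector q and
    delta = q D^-1 q^T, then mu delta <= 2 because Q <= 2 D; splitting
    mu = mu (1 - delta) + mu delta and summing, with w = q X q^T in [0, 1] as
    weights, gives tr (Q X) <= tr Q - tr (D^-1 Q) + 2k = 2m - n + 2k. Part (ii)
    follows from A_alpha = (1 - alpha) Q + (2 alpha - 1) D.

    For part (i), A_alpha = alpha Q + (1 - 2 alpha) A. Each of the m - n + 1
    edges outside T contributes 2 X_uv <= 1 to tr (A X). On T, Cauchy-Schwarz
    gives tr (A_T X)^2 <= 2 (n - 1) s, where s is the sum of X_uv^2 over the
    ordered adjacent pairs of T. Since T is bipartite, 2 s <= tr X = k, and the
    same argument for 1 - X gives the bound with n - k. A vertex cover C of T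
    with |C| <= beta' gives 2 s <= beta', as the off-diagonal part of row c of
    X has square norm X_cc - X_cc^2 <= 1/4. *)

(** * Orthogonal diagonalization of real symmetric matrices *)

Lemma row_norm_eq0 (R : realDomainType) (n : nat) (v : 'rV[R]_n) :
  (v *m v^T) 0 0 = 0 -> v = 0.
Proof.
rewrite mxE => /eqP; rewrite psumr_eq0 => [/allP v0|i _]; last first.
  by rewrite mxE -expr2 sqr_ge0.
apply/rowP=> i; rewrite mxE; apply/eqP.
by have := v0 i (mem_index_enum i); rewrite mxE mulf_eq0 orbb.
Qed.

Lemma row_norm_ge0 (R : realDomainType) (n : nat) (v : 'rV[R]_n) :
  0 <= (v *m v^T) 0 0.
Proof. by rewrite mxE sumr_ge0 // => i _; rewrite mxE -expr2 sqr_ge0. Qed.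

(** Over the algebraically closed field [R[i]] there is an eigenvector [x + i y] with eigenvalue
    [a + i b]. Symmetry forces [b = 0], and then whichever of [x], [y] is nonzero is a real
    eigenvector. *)
Lemma symmetric_eigenvector (R : rcfType) (n : nat) (M : 'M[R]_n.+1) :
  M^T = M -> exists a, exists2 v : 'rV_n.+1, v *m M = a *: v & v != 0.
Proof.
move=> symM.
have [[a b] /eigenvalueP[v vM v0]] :=
  @eigenvalue_closed R[i] _ (map_mx (real_complex R) M) isT.
pose x : 'rV_n.+1 := \row_i complex.Re (v 0 i); pose y : 'rV_n.+1 := \row_i complex.Im (v 0 i).
have ReD : {morph (@complex.Re R) : u w / u + w} by move=> [? ?] [? ?].
have ImD : {morph (@complex.Im R) : u w / u + w} by move=> [? ?] [? ?].
have xM : x *m M = a *: x - b *: y.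
  apply/rowP=> j; move/rowP/(_ j)/(congr1 (@complex.Re R)): vM.
  rewrite !mxE (big_morph _ ReD (erefl _)); case: (v 0 j) => c d /= <-.
  by apply: eq_bigr => i _; rewrite !mxE; case: (v 0 i) => p q /=; ring.
have yM : y *m M = b *: x + a *: y.
  apply/rowP=> j; move/rowP/(_ j)/(congr1 (@complex.Im R)): vM.
  rewrite !mxE (big_morph _ ImD (erefl _)); case: (v 0 j) => c d /= vj.
  rewrite [RHS]addrC -vj.
  by apply: eq_bigr => i _; rewrite !mxE; case: (v 0 i) => p q /=; ring.
(* The numbers [x M y^T] and [y M x^T] agree by symmetry of [M]; expanding both by [xM] and [yM]
   leaves exactly this product. *)
have b0 : b * ((x *m x^T) 0 0 + (y *m y^T) 0 0) = 0.
  have : (x *m M *m y^T) 0 0 = (y *m M *m x^T) 0 0.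
    rewrite -[in RHS](trmxK (y *m M *m x^T)) [RHS]mxE !trmx_mul trmxK symM.
    by rewrite mulmxA.
  have yx : (x *m y^T) 0 0 = (y *m x^T) 0 0.
    by rewrite -[in RHS](trmxK (y *m x^T)) [RHS]mxE trmx_mul trmxK.
  have lin p q (z1 z2 z3 : 'rV[R]_n.+1) : ((p *: z1 + q *: z2) *m z3^T) 0 0 =
      p * (z1 *m z3^T) 0 0 + q * (z2 *m z3^T) 0 0.
    have addE (A B : 'M[R]_1) : (A + B) 0 0 = A 0 0 + B 0 0 by rewrite mxE.
    have sclE (r : R) (A : 'M[R]_1) : (r *: A) 0 0 = r * A 0 0 by rewrite mxE.
    by rewrite mulmxDl -!scalemxAl addE !sclE.
  rewrite xM yM -scaleNr !lin -yx => h; lra.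
have xy0 : (x *m x^T) 0 0 + (y *m y^T) 0 0 != 0.
  apply: contra_neq v0 => h.
  have [/row_norm_eq0 x0 /row_norm_eq0 y0] :
      (x *m x^T) 0 0 = 0 /\ (y *m y^T) 0 0 = 0.
    by move: (row_norm_ge0 _ _ x) (row_norm_ge0 _ _ y); split; lra.
  apply/rowP=> i; move/rowP/(_ i): x0; move/rowP/(_ i): y0; rewrite !mxE.
  by case: (v 0 i) => p q /= -> ->.
move/eqP: b0; rewrite mulf_eq0 (negPf xy0) orbF => /eqP b0.
move: xM yM; rewrite b0 !scale0r subr0 add0r => xM yM.
have [x0|] := eqVneq x 0; last by exists a, x.
exists a, y => //; apply: contra_neq xy0 => ->.
by rewrite x0 !mul0mx mxE addr0.
Qed.

Lemma orthogonal_first_row (R : rcfType) (n : nat) (v : 'rV[R]_n.+1) :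
  (v *m v^T) 0 0 = 1 ->
  exists2 P : 'M[R]_n.+1, P *m P^T = 1%:M & delta_mx 0 0 *m P = v.
Proof.
move=> v1; set u : 'rV_n.+1 := delta_mx 0 0; pose w := v - u.
have [/eqP|w0] := eqVneq w 0.
  by rewrite subr_eq0 => /eqP ->; exists 1%:M; rewrite ?trmx1 mulmx1.
have nw : (w *m w^T) 0 0 != 0 by apply: contra_neq w0 => /row_norm_eq0.
pose c := 2 / (w *m w^T) 0 0.
(* Householder reflection exchanging u and v. *)
pose P := 1%:M - c *: (w^T *m w).
have wPw : w^T *m w *m (w^T *m w) = (w *m w^T) 0 0 *: (w^T *m w).
  rewrite mulmxA -(mulmxA w^T) [in LHS](mx11_scalar (w *m w^T)).
  by rewrite mul_mx_scalar -scalemxAl.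
have uw : (u *m w^T) 0 0 = v 0 0 - 1.
  by rewrite -rowE !mxE eqxx.
have ww : (w *m w^T) 0 0 = 2 - 2 * v 0 0.
  have uv : (v *m u^T) 0 0 = v 0 0 by rewrite trmx_delta -colE mxE.
  have uu : (u *m u^T) 0 0 = 1 by rewrite -rowE !mxE eqxx.
  have vu : (u *m v^T) 0 0 = v 0 0 by rewrite -rowE !mxE.
  rewrite /w linearB /= mulmxBl !mulmxBr.
  have subE (A B : 'M[R]_1) : (A - B) 0 0 = A 0 0 - B 0 0 by rewrite !mxE.
  by rewrite !subE v1 uv vu uu; ring.
exists P.
  have -> : P^T = P by rewrite /P linearB /= trmx1 linearZ /= trmx_mul trmxK.
  have cw : c * (w *m w^T) 0 0 = 2 by rewrite /c divfK.
  rewrite {}/P; move: c (_ 0 0) cw (w^T *m w) wPw => {}c r cr W WW.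
  rewrite mulmxBl mul1mx mulmxBr mulmx1 -scalemxAl -scalemxAr WW.
  by rewrite !scalerA -mulrA cr; apply/matrixP=> i j; rewrite !mxE; ring.
rewrite /P mulmxBr mulmx1 -scalemxAr mulmxA (mx11_scalar (u *m _)) mul_scalar_mx.
rewrite scalerA uw.
have -> : c * (v 0 0 - 1) = -1.
  by move: nw; rewrite /c ww => nw; field.
by rewrite scaleN1r opprK addrC subrK.
Qed.

(** Deflation: with a unit eigenvector as first row of an orthogonal [P], the matrix [P M P^T] has
    first row [a e_0], so by symmetry it is block diagonal and the induction applies to the lower
    block. *)
Lemma symmetric_diagonalization (R : rcfType) (n : nat) (M : 'M[R]_n) :
  M^T = M ->
  exists P : 'M[R]_n, exists2 d, P *m P^T = 1%:M & P *m M *m P^T = diag_mx d.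
Proof.
elim: n M => [|n IHn] M symM.
  by exists 0, 0; apply/matrixP=> -[].
have [a [v vM v0]] := @symmetric_eigenvector R n M symM.
pose r := Num.sqrt ((v *m v^T) 0 0).
have r0 : 0 < r.
  rewrite sqrtr_gt0 lt0r row_norm_ge0 andbT.
  by apply: contra_neq v0 => /row_norm_eq0.
pose u := r^-1 *: v.
have uM : u *m M = a *: u by rewrite /u -scalemxAl vM !scalerA mulrC.
have u1 : (u *m u^T) 0 0 = 1.
  rewrite /u linearZ /= -scalemxAl -scalemxAr scalerA mxE.
  rewrite -(@sqr_sqrtr _ ((v *m v^T) 0 0)) ?row_norm_ge0 // -/r.
  by have := lt0r_neq0 r0 => ?; field.
have [P PP Pu] := @orthogonal_first_row R n u u1.
pose B : 'M_(1 + n) := P *m M *m P^T.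
have symB : B^T = B by rewrite /B !trmx_mul trmxK symM mulmxA.
have row0 : row 0 B = a *: delta_mx 0 0.
  rewrite rowE /B !mulmxA Pu uM -scalemxAl -Pu -mulmxA PP mulmx1 //.
have BM : P *m M *m P^T = B by [].
clearbody B.
(* Stated through [val], because the block lemmas produce indices of ['I_(1 + n)] as left and right
   shifts. *)
have B0 i j : val i = 0%N -> B i j = a * (val j == 0%N)%:R.
  move=> i0; have -> : i = 0 by apply/val_inj.
  by move/rowP/(_ j): row0; rewrite !mxE.
have BE : B = block_mx a%:M 0 0 (drsubmx B).
  rewrite -[LHS]submxK; congr block_mx; apply/matrixP=> i j.
  - by rewrite ulsubmxEsub !mxE !ord1 B0 //= mulr1.
  - by rewrite ursubmxEsub !mxE !ord1 B0 //= mulr0.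
  - by rewrite -[in LHS]symB dlsubmxEsub !mxE !ord1 B0 //= mulr0.
have [|Q [d QQ QB]] := IHn (drsubmx B).
  by rewrite trmx_drsub symB.
pose E : 'M_(1 + n) := block_mx 1%:M 0 0 Q.
have EE : E *m E^T = 1%:M.
  rewrite tr_block_mx mulmx_block !trmx0 !trmx1 !mulmx0 !mul0mx !addr0 !add0r.
  by rewrite mulmx1 QQ -scalar_mx_block.
exists (E *m (P : 'M_(1 + n))), (row_mx a%:M d).
  by rewrite trmx_mul mulmxA -(mulmxA E) PP mulmx1.
have -> : E *m P *m M *m (E *m P)^T = E *m B *m E^T.
  by rewrite trmx_mul -BM !mulmxA.
rewrite BE /E tr_block_mx !mulmx_block !trmx0 !trmx1.
rewrite !mulmx0 !mul0mx !addr0 !add0r !mulmx1 !mul1mx QB.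
rewrite (@diag_mx_row _ n 1) mul0mx (_ : diag_mx a%:M = a%:M) //.
by apply/matrixP=> i j; rewrite !ord1 !mxE.
Qed.

Lemma orthogonal_conj_diag (R : comUnitRingType) (n : nat) (P M : 'M[R]_n) (d : 'rV_n) :
  P *m P^T = 1%:M -> P *m M *m P^T = diag_mx d -> M = P^T *m diag_mx d *m P.
Proof.
move=> PP <-; have PP' := mulmx1C PP.
by rewrite !mulmxA PP' mul1mx -mulmxA PP' mulmx1.
Qed.

Lemma char_poly_orthogonal_conj (R : comUnitRingType) (n : nat) (P M : 'M[R]_n) (d : 'rV_n) :
  P *m P^T = 1%:M -> P *m M *m P^T = diag_mx d ->
  char_poly M = \prod_(i < n) ('X - (d 0 i)%:P).
Proof.
move=> PP dM.
have -> : char_poly M = char_poly (diag_mx d).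
  rewrite /char_poly -dM /char_poly_mx.
  pose p := map_mx polyC P.
  have pp : p *m p^T = 1%:M by rewrite /p map_trmx -map_mxM PP map_mx1.
  have -> : 'X%:M - map_mx polyC (P *m M *m P^T) =
      p *m ('X%:M - map_mx polyC M) *m p^T.
    rewrite !map_mxM -map_trmx -/p mulmxBr mulmxBl; congr (_ - _).
    by rewrite mul_mx_scalar -scalemxAl pp -mul_scalar_mx mulmx1.
  by rewrite !det_mulmx mulrAC -det_mulmx pp det1 mul1r.
rewrite char_poly_trig ?diag_mx_is_trig //.
by apply: eq_bigr => i _; rewrite !mxE eqxx.
Qed.

(** * Eigenvalue sums as traces against projections *)

Lemma S_k_projection (R : realType) (n k : nat) (M : 'M[R]_n) (s : seq R) :
  M^T = M -> eigenvalues_desc M s -> (k <= n)%N ->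
  exists X : 'M[R]_n,
    [/\ X^T = X, X *m X = X, \tr X = k%:R & S_k s k = \tr (M *m X)].
Proof.
move=> symM [_ chM] kn.
have [P [d PP dM]] := @symmetric_diagonalization R n M symM.
(* Two splittings of [char_poly M] into linear factors have the same roots with multiplicity, so [s]
   lists the diagonal [d] in the order given by [p]. *)
have /tuple_permP[p sE] : perm_eq s [tuple d 0 i | i < n].
  apply: prod_XsubC_eq; rewrite -chM (char_poly_orthogonal_conj _ _ _ _ _ PP dM).
  by rewrite big_tuple; apply: eq_bigr => i _; rewrite tnth_mktuple.
(* [D] marks the positions [p i] with [i < k], those whose diagonal entries are the first [k]
   members of [s]. *)
pose D : 'rV[R]_n := \row_i (p^-1%g i < k)%N%:R.
have trE (e : 'rV[R]_n) : \tr (P^T *m diag_mx e *m P) = \sum_i e 0 i.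
  by rewrite mxtrace_mulC mulmxA PP mul1mx mxtrace_diag.
have DD : diag_mx D *m diag_mx D = diag_mx D.
  rewrite mulmx_diag; congr diag_mx; apply/rowP=> i; rewrite !mxE.
  by case: (_ < k)%N; rewrite ?mulr1 ?mulr0.
exists (P^T *m diag_mx D *m P); split.
- by rewrite !trmx_mul trmxK tr_diag_mx mulmxA.
- by rewrite !mulmxA -(mulmxA _ P) PP mulmx1 -(mulmxA _ _ (diag_mx D)) DD.
- rewrite trE (reindex_inj (@perm_inj _ p)) /=.
  under eq_bigr do rewrite mxE permK mulrb.
  by rewrite -big_mkcond big_ord_narrow // sumr_const card_ord.
rewrite (orthogonal_conj_diag _ _ _ _ _ PP dM).
rewrite !mulmxA -(mulmxA _ P) PP mulmx1 -(mulmxA _ (diag_mx d) (diag_mx D)) mulmx_diag trE.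
rewrite (reindex_inj (@perm_inj _ p)) /=.
rewrite /S_k (big_ord_widen _ (fun i => s`_i) kn) big_mkcond /=.
apply: eq_bigr => i _; rewrite !mxE permK sE (nth_map i) ?size_enum_ord //.
rewrite nth_ord_enum tnth_mktuple; case: ifP; by rewrite ?mulr1 ?mulr0.
Qed.

(** * Edge counts, two-colourings and vertex covers of trees *)

Lemma degreeE (n : nat) (e : rel 'I_n) (i : 'I_n) :
  degree e i = (\sum_j e i j)%N.
Proof. by rewrite /degree -sum1dep_card big_mkcond; apply: eq_bigr => j; case: (e i j). Qed.

Lemma sum_degree (n : nat) (e : rel 'I_n) :
  simple_graph e -> (\sum_i degree e i = 2 * num_edges e)%N.
Proof.
move=> [symE irrE].
under eq_bigr do rewrite degreeE.
rewrite pair_big /= (bigID (fun p : 'I_n * 'I_n => p.1 < p.2)%N) /=.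
have -> : num_edges e = (\sum_(p : 'I_n * 'I_n | (p.1 < p.2)%N) e p.1 p.2)%N.
  rewrite /num_edges -sum1dep_card big_mkcondr /=.
  by apply: eq_bigr => p _; case: (e _ _).
rewrite mul2n -addnn; congr addn.
(* Swapping coordinates matches the pairs with [p.1 > p.2] to those with [p.1 < p.2]; the diagonal
   contributes nothing by irreflexivity. *)
rewrite (reindex_inj (h := fun p : 'I_n * 'I_n => (p.2, p.1))) /=; last first.
  by move=> [? ?] [? ?] [-> ->].
rewrite [LHS]big_mkcond [RHS]big_mkcond /=; apply: eq_bigr => -[i j] _ /=.
rewrite symE; have [||/val_inj->] := ltngtP i j; rewrite ?irrE //.
Qed.

(* v is the endpoint of a longest simple path inside S: a neighbour in S other
   than the next vertex would extend the path or close a cycle. *)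
Lemma acyclic_leaf (n : nat) (t : rel 'I_n) (S : {set 'I_n}) :
  simple_graph t -> acyclic t -> S != set0 ->
  exists2 v, v \in S & {in S &, forall u w, t v u -> t v w -> u = w}.
Proof.
move=> [symT irrT] acT /set0Pn[v0 v0S].
pose good m := [exists p : m.+1.-tuple 'I_n,
  [&& uniq p, all [in S] p & path t (thead p) (behead p)]].
have good0 : good 0.
  by apply/existsP; exists [tuple v0]; rewrite /= v0S.
have goodn m : good m -> (m <= n)%N.
  move=> /existsP[p /and3P[/card_uniqP pu _ _]].
  by rewrite -ltnS -(size_tuple p) -pu (leq_trans (max_card _)) ?card_ord.
case: (ex_maxnP (ex_intro good 0%N good0) goodn) => m /existsP[p].
case/tupleP: p => v p; rewrite theadE /= => /and3P[/andP[vp up] /andP[vS pS] tp] maxm.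
exists v => // u w uS wS vu vw.
have nbr x : x \in S -> t v x -> x \in val p.
  move=> xS vx; case: (boolP (x \in val p)) => // xp.
  have := maxm m.+1; rewrite ltnn; apply.
  apply/existsP; exists [tuple of x :: v :: p].
  rewrite theadE /= inE negb_or xp vp up xS vS pS symT vx tp /= !andbT.
  by apply: contraTneq vx => ->; rewrite irrT.
suff nbr_head x : x \in S -> t v x -> x = nth v p 0.
  by rewrite (nbr_head u) // (nbr_head w).
move=> xS vx; have xp := nbr x xS vx; pose i := index x p.
have xi : nth v p i = x by rewrite nth_index.
case E : i => [|j]; first by rewrite -E.
have := acT (v :: take i.+1 p).
have ip : (i < size p)%N by rewrite index_mem.
rewrite /= size_takel // E => /(_ isT).
have tu : uniq (v :: take i.+1 p).
  by rewrite /= take_uniq // andbT (contra _ vp) // => /mem_take.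
rewrite -E => /(_ tu) /negP[].
rewrite rcons_path take_path //= (last_nth v) size_takel //= nth_take //.
by rewrite xi symT.
Qed.

(** Row and column [v] contribute equally by symmetry. As [f v v] vanishes, the row may be summed
    over all of [S]. *)
Lemma setD1_sum (n : nat) (f : 'I_n -> 'I_n -> nat) (S : {set 'I_n}) (v : 'I_n) :
  v \in S -> (forall i j, f i j = f j i) -> f v v = 0%N ->
  (\sum_(i in S) \sum_(j in S) f i j =
   \sum_(i in S :\ v) \sum_(j in S :\ v) f i j + 2 * \sum_(j in S) f v j)%N.
Proof.
move=> vS symf fvv.
have inner i : (\sum_(j in S) f i j = f i v + \sum_(j in S :\ v) f i j)%N.
  by rewrite (big_setD1 v).
rewrite (big_setD1 v vS) /= (eq_bigr _ (fun i _ => inner i)) big_split /= inner.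
rewrite (eq_bigr _ (fun i _ => symf i v)) fvv.
by rewrite !add0n addnA addnn addnC mul2n.
Qed.

Lemma leaf_degree (n : nat) (t : rel 'I_n) (S : {set 'I_n}) (v : 'I_n) :
  {in S &, forall u w, t v u -> t v w -> u = w} -> (\sum_(j in S) t v j <= 1)%N.
Proof.
move=> leaf; have -> : (\sum_(j in S) t v j = #|[set j in S | t v j]|)%N.
  rewrite -sum1dep_card big_mkcondr /=.
  by apply: eq_bigr => j _; case: (t v j).
apply/card_le1_eqP => u w; rewrite !inE => /andP[uS vu] /andP[wS vw].
exact: leaf.
Qed.

(** Leaves are removed one at a time: each removal costs at most one edge, that is two ordered
    pairs, and the last vertex carries none. *)
Lemma acyclic_edges (n : nat) (t : rel 'I_n) (S : {set 'I_n}) :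
  simple_graph t -> acyclic t -> S != set0 ->
  (\sum_(i in S) \sum_(j in S) t i j + 2 <= 2 * #|S|)%N.
Proof.
move=> gt acT; move: {2}#|S| (erefl #|S|) => k; elim: k S => [|k IHk] S cS S0.
  by rewrite -cards_eq0 cS in S0.
have [v vS leaf] := acyclic_leaf _ _ _ gt acT S0.
have cSv : #|S :\ v| = k by move: cS; rewrite (cardsD1 v) vS => -[].
rewrite (setD1_sum _ _ _ v) //= => [|i j|]; last 2 first.
- by rewrite gt.1.
- by rewrite gt.2.
have := leaf_degree _ _ _ _ leaf; rewrite cS.
have [Sv0|/(IHk _ cSv)] := eqVneq (S :\ v) set0; last first.
  rewrite cSv; set x := (\sum_(i in _) _)%N; set y := (\sum_(j in S) _)%N.
  lia.
rewrite Sv0 big_set0 (big_setD1 v) //= Sv0 big_set0 gt.2.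
lia.
Qed.

(** A maximal set that contains [ord0] and spans enough edges is closed under adjacency, since
    adjoining a neighbour brings at least one new edge. Connectedness makes it the whole vertex
    set. *)
Lemma connected_edges (n : nat) (t : rel 'I_n) :
  simple_graph t -> connected_graph t ->
  (2 * n <= \sum_i \sum_j t i j + 2)%N.
Proof.
case: n t => // n t gt coT.
pose good (S : {set 'I_n.+1}) :=
  (ord0 \in S) && (2 * #|S| <= \sum_(i in S) \sum_(j in S) t i j + 2)%N.
have good0 : good [set ord0].
  by rewrite /good inE eqxx cards1; lia.
have [S /maxsetP[/andP[S0 cS] maxS] _] := maxset_exists good0.
suff ST : S = setT.
  move: cS; rewrite ST cardsT card_ord.
  by under eq_bigl do rewrite inE; under eq_bigr do under eq_bigl do rewrite inE.
have closS : closed t S.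
  apply: (intro_closed (sym_connect_sym _)) => [|i j tij iS].
    exact: gt.1.
  apply/negPn/negP => jS.
  have : j |: S = S.
    apply: maxS; last exact: subsetUr.
    rewrite /good !inE S0 orbT /= cardsU1 jS add1n.
    rewrite (setD1_sum _ _ _ j) ?setU11 //= => [|u w|]; last 2 first.
    - by rewrite gt.1.
    - by rewrite gt.2.
    have dj : (0 < \sum_(u in j |: S) t j u)%N.
      by rewrite (bigD1 i) ?inE ?iS ?orbT //= gt.1 tij.
    move: cS dj; rewrite setU1K //.
    set x := (\sum_(u in S) _)%N; set y := (\sum_(u in j |: S) _)%N.
    set z := #|_|; lia.
  by move=> jSS; rewrite -jSS setU11 in jS.
apply/setP => i; rewrite inE -S0; apply/esym.
exact: closed_connect closS _ _ (coT ord0 i).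
Qed.

Lemma tree_num_edges (n : nat) (t : rel 'I_n) :
  simple_graph t -> connected_graph t -> acyclic t -> (0 < n)%N ->
  (num_edges t).+1 = n.
Proof.
move=> gt coT acT n0.
have lo := connected_edges _ _ gt coT.
have up : (\sum_i \sum_j t i j + 2 <= 2 * n)%N.
  have /(acyclic_edges _ _ _ gt acT) : [set: 'I_n] != set0.
    by apply/set0Pn; exists (Ordinal n0).
  rewrite cardsT card_ord; under eq_bigl do rewrite inE.
  by under eq_bigr do under eq_bigl do rewrite inE.
have := sum_degree _ _ gt; under eq_bigr do rewrite degreeE.
by move: lo up; set x := (\sum_i _)%N; lia.
Qed.

(** Induction on the vertex set: remove a leaf, colour the rest, then give the leaf the colour
    opposite to that of its only possible neighbour. *)
Lemma acyclic_bipartite (n : nat) (t : rel 'I_n) :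
  simple_graph t -> acyclic t ->
  exists c : 'I_n -> bool, forall i j, t i j -> c i != c j.
Proof.
move=> gt acT.
suff H (S : {set 'I_n}) :
    exists c : 'I_n -> bool, {in S &, forall i j, t i j -> c i != c j}.
  by have [c cP] := H setT; exists c => i j; apply: cP; rewrite inE.
move: {2}#|S| (erefl #|S|) => k; elim: k S => [|k IHk] S cS.
  by move/eqP: cS; rewrite cards_eq0 => /eqP->; exists xpredT => i j; rewrite inE.
have S0 : S != set0 by rewrite -cards_eq0 cS.
have [v vS leaf] := acyclic_leaf _ _ _ gt acT S0.
have [|c cP] := IHk (S :\ v); first by move: cS; rewrite (cardsD1 v) vS => -[].
pose b := [exists u in S, t v u && ~~ c u].
have bP u : u \in S -> t v u -> b != c u.
  move=> uS vu; rewrite /b; case: existsP => [[w /and3P[wS vw]]|nex].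
    by rewrite (leaf u w) // => /negPf->.
  by apply/negP => /eqP cu; apply: nex; exists u; rewrite uS vu -cu.
exists (fun i => if i == v then b else c i) => i j iS jS.
have [->|iv] := eqVneq i v; have [->|jv] := eqVneq j v.
- by rewrite gt.2.
- exact: bP.
- by rewrite gt.1 eq_sym; apply: bP.
- by apply: cP; rewrite !inE ?iv ?jv.
Qed.

(** One half of König's theorem, for forests. If the leaf [v] has neighbour [u], the edge [uv] joins
    the matching, [u] joins the cover, and both vertices are removed; so the cover never outgrows
    the matching. *)
Lemma acyclic_vertex_cover (n : nat) (t : rel 'I_n) :
  simple_graph t -> acyclic t ->
  exists2 C : {set 'I_n}, (#|C| <= matching_number t)%N &
    forall i j, t i j -> (i \in C) || (j \in C).
Proof.
move=> gt acT.
(* Keeping the matching inside [S] is what makes the edge added later disjoint from it. *)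
suff H (S : {set 'I_n}) : exists C : {set 'I_n}, exists M : {set 'I_n * 'I_n},
    [/\ is_matching t M, {in M, forall p, (p.1 \in S) && (p.2 \in S)},
        (#|C| <= #|M|)%N & {in S &, forall i j, t i j -> (i \in C) || (j \in C)}].
  have [C [M [mM _ cC covC]]] := H setT; exists C.
    by apply: leq_trans cC _; apply: leq_bigmax_cond.
  by move=> i j; apply: covC; rewrite inE.
have [k] := ubnP #|S|; elim: k S => // k IHk S cS.
have [->|S0] := eqVneq S set0.
  exists set0, set0; split.
  - by apply/andP; split; apply/forall_inP => p; rewrite inE.
  - by move=> p; rewrite inE.
  - by rewrite !cards0.
  - by move=> i j; rewrite inE.
have [v vS leaf] := acyclic_leaf _ _ _ gt acT S0.
have cSv : (#|S :\ v| < k)%N by move: cS; rewrite (cardsD1 v) vS.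
have [u /andP[uS vu]|iso] := pickP [pred u in S | t v u]; last first.
  have [C [M [mM MS cC covC]]] := IHk _ cSv; exists C, M; split=> //.
    by move=> p /MS; rewrite !inE => /andP[/andP[_ ->] /andP[_ ->]].
  move=> i j iS jS tij; apply: covC => //; rewrite !inE ?iS ?jS andbT.
    by apply: contraTneq tij => iv; have := iso j; rewrite /= jS -iv => /= ->.
  by apply: contraTneq tij => jv; have := iso i; rewrite /= iS -jv gt.1 => /= ->.
have uv : u != v by apply: contraTneq vu => ->; rewrite gt.2.
have cSuv : (#|S :\ v :\ u| < k)%N.
  by apply: leq_ltn_trans cSv; apply: subset_leq_card; apply: subsetDl.
have [C [M [mM MS cC covC]]] := IHk _ cSuv.
(* Matchings store an edge with its smaller endpoint first. *)
pose q := if (u < v)%N then (u, v) else (v, u).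
have qM : q \notin M.
  by apply/negP => /MS; rewrite /q; case: ifP; rewrite /= !inE eqxx ?andbF.
have disj p : p \in M -> [&& p.1 != q.1, p.1 != q.2, p.2 != q.1 & p.2 != q.2].
  move=> /MS; rewrite !inE => /andP[/and3P[p1u p1v _] /and3P[p2u p2v _]].
  by rewrite /q; case: ifP; rewrite /= p1u p1v p2u p2v.
exists (u |: C), (q |: M); split.
- have /andP[/forall_inP m1 /forall_inP m2] := mM; apply/andP; split.
    apply/forall_inP => p; rewrite !inE => /predU1P[->|/m1 //].
    rewrite /q; case: ifP => /= [-> | /negbT]; first by rewrite gt.1.
    by rewrite -leqNgt leq_eqVlt vu andbT eq_sym => /predU1P[/val_inj/eqP|->//]; rewrite (negPf uv).
  apply/forall_inP => p; rewrite !inE => /predU1P[->|pM].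
    apply/forall_inP => r; rewrite !inE => /predU1P[->|rM]; first by rewrite eqxx.
    apply/implyP => _; have := disj r rM.
    by rewrite ![r.1 == _]eq_sym ![r.2 == _]eq_sym => /and4P[-> -> -> ->].
  apply/forall_inP => r; rewrite !inE => /predU1P[->|rM].
    by apply/implyP => _; exact: disj.
  by have /forall_inP := m2 p pM; apply.
- move=> p; rewrite !inE => /predU1P[->|/MS].
    by rewrite /q; case: ifP; rewrite /= uS vS.
  by rewrite !inE => /andP[/and3P[_ _ ->] /and3P[_ _ ->]].
- by rewrite !cardsU1 qM; apply: leq_add => //; case: (_ \notin _).
- move=> i j iS jS tij; rewrite !inE.
  have [//|iu /=] := eqVneq i u; have [|ju /=] := eqVneq j u; first by rewrite orbT.
  (* Neither end is [u], hence neither is [v], whose only neighbour in [S] is [u]; the edge lies in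
     the smaller set. *)
  apply: covC => //; rewrite !inE ?iu ?ju ?iS ?jS andbT /=.
    by apply: contra_neq ju => iv; apply: leaf; rewrite // -iv.
  by apply: contra_neq iu => jv; apply: leaf; rewrite // -jv gt.1.
Qed.

(** The first endpoints of the edges of a matching are distinct. *)
Lemma matching_number_le (n : nat) (t : rel 'I_n) : (matching_number t <= n)%N.
Proof.
apply/bigmax_leqP => M /andP[_ /forall_inP mM].
have inj : {in M &, injective fst}.
  move=> p q pM qM /= pq; apply/eqP; apply: contraT => npq.
  by have /forall_inP/(_ q qM) := mM p pM; rewrite npq pq eqxx.
by rewrite -(card_in_imset inj) -[leqRHS](card_ord n) max_card.
Qed.

(** * Traces against projections and entries of projections *)

Lemma trace_adjacency (R : realType) (n : nat) (e : rel 'I_n) (X : 'M[R]_n) :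
  X^T = X -> \tr (adjacency_mx R e *m X) = \sum_i \sum_(j | e i j) X i j.
Proof.
move=> symX; rewrite /mxtrace; apply: eq_bigr => i _; rewrite !mxE [RHS]big_mkcond /=.
apply: eq_bigr => j _; rewrite !mxE -{1}symX mxE.
by case: (e i j); rewrite ?mul1r ?mul0r.
Qed.

Lemma trace_degree (R : realType) (n : nat) (e : rel 'I_n) (X : 'M[R]_n) :
  \tr (degree_mx R e *m X) = \sum_i (degree e i)%:R * X i i.
Proof.
by rewrite /mxtrace; apply: eq_bigr => i _; rewrite mul_diag_mx !mxE.
Qed.

Lemma projection_row_sqr (R : comNzRingType) (n : nat) (X : 'M[R]_n) (i : 'I_n) :
  X^T = X -> X *m X = X -> \sum_j X i j ^+ 2 = X i i.
Proof.
move=> symX XX; rewrite -[in RHS]XX mxE; apply: eq_bigr => j _.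
by rewrite -[in X j i]symX mxE expr2.
Qed.

Lemma projection_diag_itv (R : realDomainType) (n : nat) (X : 'M[R]_n) (i : 'I_n) :
  X^T = X -> X *m X = X -> 0 <= X i i <= 1.
Proof.
move=> symX XX; have := projection_row_sqr R n X i symX XX.
rewrite (bigD1 i) //=.
have : 0 <= \sum_(j | j != i) X i j ^+ 2 by apply: sumr_ge0 => j _; apply: sqr_ge0.
by move: (X i i) (\sum_(_ | _) _) => x y; nra.
Qed.

Lemma projection_offdiag_sqr (R : realDomainType) (n : nat) (X : 'M[R]_n) (i : 'I_n) :
  X^T = X -> X *m X = X -> 4 * \sum_(j | j != i) X i j ^+ 2 <= 1.
Proof.
move=> symX XX; have := projection_row_sqr R n X i symX XX.
rewrite (bigD1 i) //=; have := sqr_ge0 (2 * X i i - 1).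
by move: (X i i) (\sum_(_ | _) _) => x y; lra.
Qed.

(** A single off-diagonal entry has square at most 1/4. This bounds the contribution of each edge
    outside the tree. *)
Lemma projection_offdiag_le (R : realDomainType) (n : nat) (X : 'M[R]_n) (i j : 'I_n) :
  X^T = X -> X *m X = X -> i != j -> 2 * X i j <= 1.
Proof.
move=> symX XX ij; have := projection_offdiag_sqr R n X i symX XX.
rewrite (bigD1 j) 1?eq_sym //=.
have : 0 <= \sum_(k | (k != i) && (k != j)) X i k ^+ 2.
  by apply: sumr_ge0 => k _; apply: sqr_ge0.
by move: (X i j) (\sum_(_ | _) _) => x y; nra.
Qed.

(** * Cauchy-Schwarz bounds on adjacency traces *)

Lemma sum_sqr_le (R : realDomainType) (I : finType) (P : pred I) (f : I -> R) :
  (\sum_(i | P i) f i) ^+ 2 <= #|P|%:R * \sum_(i | P i) f i ^+ 2.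
Proof.
have [P0|/card_gt0P N0] := posnP #|P|.
  rewrite !big_pred0 ?P0 ?expr0n ?mul0r // => i; by rewrite -[P i]/(i \in P) (card0_eq P0).
set N : R := #|P|%:R; set S := \sum_(i | P i) f i.
have {}N0 : 0 < N by rewrite ltr0n; apply/card_gt0P.
(* With [Q] the sum of the squares, this sum expands to [N (N Q - S^2)], and [N] is positive. *)
have : 0 <= \sum_(i | P i) (N * f i - S) ^+ 2.
  by apply: sumr_ge0 => i _; apply: sqr_ge0.
rewrite (eq_bigr (fun i => N ^+ 2 * f i ^+ 2 + (- (2 * N * S) * f i + S ^+ 2))).
  rewrite !big_split /= -!mulr_sumr -/S sumr_const -mulr_natl -/N.
  by move=> h; rewrite -(ler_pM2l N0); move: h; move: (bigop _ _ _) => Q; lra.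
by move=> i _; ring.
Qed.

Lemma card_arcs (n : nat) (t : rel 'I_n) :
  simple_graph t -> #|[pred p : 'I_n * 'I_n | t p.1 p.2]| = (2 * num_edges t)%N.
Proof.
move=> gt; rewrite -sum_degree // -sum1_card big_mkcond /=.
under [RHS]eq_bigr do rewrite degreeE.
by rewrite pair_big; apply: eq_bigr => p _ /=; rewrite !inE; case: (t _ _).
Qed.

Lemma trace_adjacency_sqr_le (R : realType) (n : nat) (t : rel 'I_n) (X : 'M[R]_n) (y : R) :
  simple_graph t -> X^T = X ->
  2 * (\sum_i \sum_(j | t i j) X i j ^+ 2) <= y ->
  \tr (adjacency_mx R t *m X) ^+ 2 <= y * (num_edges t)%:R.
Proof.
move=> gt symX; rewrite trace_adjacency // !pair_big_dep /= => ley.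
have := sum_sqr_le R _ [pred p : 'I_n * 'I_n | t p.1 p.2] (fun p => X p.1 p.2).
rewrite card_arcs //= => h; apply: le_trans h _.
by rewrite natrM mulrC mulrA; apply: ler_wpM2r => //; rewrite mulrC.
Qed.

(** The absolute value serves the passage from [X] to [1 - X], under which the trace changes
    sign. *)
Lemma abs_trace_adjacency_le (R : realType) (n : nat) (t : rel 'I_n) (X : 'M[R]_n) (y : nat) :
  simple_graph t -> X^T = X ->
  2 * (\sum_i \sum_(j | t i j) X i j ^+ 2) <= y%:R ->
  `|\tr (adjacency_mx R t *m X)| <= Num.sqrt (y * num_edges t)%:R.
Proof.
move=> gt symX ley; rewrite -sqrtr_sqr ler_sqrt ?ler0n // natrM.
exact: trace_adjacency_sqr_le.
Qed.

Lemma trace_sqr_ge0 (R : realDomainType) (n : nat) (Y : 'M[R]_n) :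
  Y^T = Y -> 0 <= \tr (Y *m Y).
Proof.
move=> symY; apply: sumr_ge0 => i _; rewrite mxE; apply: sumr_ge0 => j _.
by rewrite -[in Y j i]symY mxE -expr2 sqr_ge0.
Qed.

(* With signs s_i = +-1 on the two colour classes, the sum of s_i s_j X_ij^2 is
   tr (S X S X) = ||X S X||^2 >= 0, so at most half of ||X||^2 = tr X sits
   between the classes. *)
Lemma bipartite_sqr_le (R : realType) (n k : nat) (t : rel 'I_n) (c : 'I_n -> bool)
  (X : 'M[R]_n) :
  (forall i j, t i j -> c i != c j) ->
  X^T = X -> X *m X = X -> \tr X = k%:R ->
  2 * (\sum_i \sum_(j | t i j) X i j ^+ 2) <= k%:R.
Proof.
move=> cP symX XX trX.
pose S : 'M[R]_n := diag_mx (\row_i (-1) ^+ c i).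
pose Y := X *m S *m X.
have symY : Y^T = Y by rewrite /Y !trmx_mul symX tr_diag_mx mulmxA.
have := trace_sqr_ge0 _ _ _ symY.
have -> : \tr (Y *m Y) = \sum_i \sum_j (-1) ^+ (c i (+) c j) * X i j ^+ 2.
  (* Cyclicity of the trace and [X X = X] absorb two of the four factors [X]. *)
  have -> : \tr (Y *m Y) = \tr (S *m X *m (S *m X)).
    rewrite /Y !mulmxA -(mulmxA _ X X) XX mxtrace_mulC !mulmxA XX.
    by rewrite -!mulmxA mxtrace_mulC !mulmxA.
  rewrite /mxtrace; apply: eq_bigr => i _; rewrite mxE; apply: eq_bigr => j _.
  rewrite !mul_diag_mx !mxE signr_addb -[in X j i]symX mxE; ring.
move=> h; rewrite -trX /mxtrace -subr_ge0 mulr_sumr -sumrB.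
apply: le_trans h _; apply: ler_sum => i _.
rewrite -(projection_row_sqr _ _ _ _ symX XX) mulr_sumr.
rewrite [X in _ - X]big_mkcond -sumrB.
(* For an adjacent pair the colours differ and both sides equal [- X i j ^+ 2]. For any other pair
   the right side is [X i j ^+ 2], which dominates either sign. *)
apply: ler_sum => j _; case: ifP => [/cP|_].
  by have := sqr_ge0 (X i j); case: (c i); case: (c j) => //= h _; rewrite ?expr1; lra.
by have := sqr_ge0 (X i j); case: (c i (+) c j) => /= ?; rewrite ?expr1 ?expr0; lra.
Qed.

(** Every ordered adjacent pair has its first or its second index in [C], so by symmetry the sum is
    at most twice the off-diagonal part of the rows in [C], each of which is at most 1/4. *)
Lemma cover_sqr_le (R : realType) (n : nat) (t : rel 'I_n) (C : {set 'I_n})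
  (X : 'M[R]_n) :
  simple_graph t -> (forall i j, t i j -> (i \in C) || (j \in C)) ->
  X^T = X -> X *m X = X ->
  2 * (\sum_i \sum_(j | t i j) X i j ^+ 2) <= #|C|%:R.
Proof.
move=> gt covC symX XX.
have row_le : 4 * (\sum_(i in C) \sum_(j | j != i) X i j ^+ 2) <= #|C|%:R.
  rewrite mulr_sumr -sumr_const; apply: ler_sum => i _.
  exact: projection_offdiag_sqr.
pose f i j := (t i j)%:R * X i j ^+ 2.
have f_ge0 i j : 0 <= f i j by rewrite mulr_ge0 ?ler0n ?sqr_ge0.
have fC i j : f i j = f j i by rewrite /f gt.1 -{1}symX mxE.
have fE i : \sum_(j | t i j) X i j ^+ 2 = \sum_j f i j.
  rewrite big_mkcond; apply: eq_bigr => j _.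
  by rewrite /f; case: (t i j); rewrite ?mul1r ?mul0r.
have -> : \sum_i \sum_(j | t i j) X i j ^+ 2 = \sum_i \sum_j f i j.
  by apply: eq_bigr => i _; apply: fE.
have : \sum_i \sum_j f i j <=
    \sum_i \sum_j (i \in C)%:R * f i j + \sum_i \sum_j (j \in C)%:R * f i j.
  rewrite -big_split; apply: ler_sum => i _; rewrite -big_split; apply: ler_sum => j _.
  rewrite /= -mulrDl; case tij: (t i j); last by rewrite /f tij mul0r mulr0.
  apply: ler_peMl => //; rewrite -natrD ler1n.
  by have := covC i j tij; case: (_ \in _) => //=; case: (_ \in _).
rewrite [X in _ + X]exchange_big /=.
under [X in _ + X]eq_bigr do under eq_bigr do rewrite fC.
have le1 : \sum_i \sum_j (i \in C)%:R * f i j <= \sum_(i in C) \sum_(j | j != i) X i j ^+ 2.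
  rewrite [leRHS]big_mkcond; apply: ler_sum => i _; rewrite -mulr_sumr.
  case: (i \in C); last by rewrite mul0r.
  rewrite mul1r -fE [leLHS]big_mkcond [leRHS]big_mkcond; apply: ler_sum => j _.
  have [->|_] := eqVneq j i; first by rewrite gt.2.
  by case: ifP; rewrite ?sqr_ge0.
move: row_le le1; do 3!move: (bigop _ _ _) => ?; lra.
Qed.

(** * Trace bounds for the signless Laplacian and the degree matrix *)

Lemma signless_laplacian_ge0 (R : realType) (n : nat) (e : rel 'I_n) (z : 'rV[R]_n) :
  simple_graph e ->
  0 <= (z *m (degree_mx R e + adjacency_mx R e) *m z^T) 0 0
    <= 2 * (z *m degree_mx R e *m z^T) 0 0.
Proof.
move=> ge.
have AE : (z *m adjacency_mx R e *m z^T) 0 0 = \sum_i \sum_j (e i j)%:R * (z 0 i * z 0 j).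
  rewrite mxE; under eq_bigr do rewrite !mxE mulr_suml.
  rewrite exchange_big; apply: eq_bigr => i _; apply: eq_bigr => j _.
  rewrite !mxE; ring.
have DE : (z *m degree_mx R e *m z^T) 0 0 = \sum_i \sum_j (e i j)%:R * z 0 i ^+ 2.
  rewrite mul_mx_diag mxE; apply: eq_bigr => i _.
  by rewrite !mxE degreeE natr_sum -mulr_suml; ring.
have DE' : (z *m degree_mx R e *m z^T) 0 0 = \sum_i \sum_j (e i j)%:R * z 0 j ^+ 2.
  rewrite DE exchange_big; apply: eq_bigr => i _; apply: eq_bigr => j _.
  by rewrite ge.1.
have addE (U V : 'M[R]_1) : (U + V) 0 0 = U 0 0 + V 0 0 by rewrite mxE.
rewrite mulmxDr mulmxDl addE.
(* Twice the forms of [D + A] and [D - A] are sums of the squares of [z_i + z_j] and [z_i - z_j]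
   over ordered adjacent pairs. The first yields the lower bound, the second [D + A <= 2 D]. *)
have p2 : 2 * ((z *m degree_mx R e *m z^T) 0 0 + (z *m adjacency_mx R e *m z^T) 0 0) =
    \sum_i \sum_j (e i j)%:R * (z 0 i + z 0 j) ^+ 2.
  rewrite mulrDr mulrDl mul1r {1}DE DE' AE mulr_sumr -!big_split.
  apply: eq_bigr => i _; rewrite mulr_sumr -!big_split.
  by apply: eq_bigr => j _ /=; ring.
have m2 : 2 * ((z *m degree_mx R e *m z^T) 0 0 - (z *m adjacency_mx R e *m z^T) 0 0) =
    \sum_i \sum_j (e i j)%:R * (z 0 i - z 0 j) ^+ 2.
  rewrite mulrBr mulrDl mul1r {1}DE DE' AE mulr_sumr -!big_split -sumrB.
  apply: eq_bigr => i _; rewrite mulr_sumr -!big_split -sumrB.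
  by apply: eq_bigr => j _ /=; ring.
have : 0 <= \sum_i \sum_j (e i j)%:R * (z 0 i + z 0 j) ^+ 2.
  by do 2!apply: sumr_ge0 => ? _; rewrite mulr_ge0 ?sqr_ge0.
have : 0 <= \sum_i \sum_j (e i j)%:R * (z 0 i - z 0 j) ^+ 2.
  by do 2!apply: sumr_ge0 => ? _; rewrite mulr_ge0 ?sqr_ge0.
rewrite -p2 -m2; lra.
Qed.

Lemma adjacency_mx_sym (R : realType) (n : nat) (e : rel 'I_n) :
  symmetric e -> (adjacency_mx R e)^T = adjacency_mx R e.
Proof. by move=> symE; apply/matrixP=> i j; rewrite !mxE symE. Qed.

Lemma degree_mx_sym (R : realType) (n : nat) (e : rel 'I_n) :
  (degree_mx R e)^T = degree_mx R e.
Proof. exact: tr_diag_mx. Qed.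

Lemma trace_degree_mx (R : realType) (n : nat) (e : rel 'I_n) :
  simple_graph e -> \tr (degree_mx R e) = (2 * num_edges e)%:R.
Proof.
move=> ge; rewrite mxtrace_diag -sum_degree // natr_sum.
by apply: eq_bigr => i _; rewrite mxE.
Qed.

Lemma adjacency_mx_diag (R : realType) (n : nat) (e : rel 'I_n) (i : 'I_n) :
  simple_graph e -> adjacency_mx R e i i = 0.
Proof. by move=> ge; rewrite mxE ge.2. Qed.

Lemma trace_adjacency_mx (R : realType) (n : nat) (e : rel 'I_n) :
  simple_graph e -> \tr (adjacency_mx R e) = 0.
Proof. by move=> ge; apply: big1 => i _; apply: adjacency_mx_diag. Qed.

(* The form Q at q D^-1 - delta q is nonnegative, which gives
   delta^2 mu <= (q D^-1) Q (q D^-1)^T <= 2 delta. *)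
Lemma eigenvalue_delta_le (R : realType) (n : nat) (e : rel 'I_n) (q : 'rV[R]_n) (mu : R) :
  simple_graph e -> (forall i, (0 < degree e i)%N) ->
  q *m (degree_mx R e + adjacency_mx R e) = mu *: q -> (q *m q^T) 0 0 = 1 ->
  let delta := (q *m diag_mx (\row_i (degree e i)%:R^-1) *m q^T) 0 0 in
  [/\ 0 <= mu, 0 <= delta, delta <= 1 & mu * delta <= 2].
Proof.
move=> ge dpos; set Q := _ + _; set Di := diag_mx _ => qQ q1 delta.
have Q_ge0 (z : 'rV[R]_n) : 0 <= (z *m Q *m z^T) 0 0.
  by have /andP[] := signless_laplacian_ge0 R n e z ge.
have sclE (r : R) (B : 'M[R]_1) : (r *: B) 0 0 = r * B 0 0 by rewrite mxE.
have subE (B C : 'M[R]_1) : (B - C) 0 0 = B 0 0 - C 0 0 by rewrite !mxE.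
have mu0 : 0 <= mu by have := Q_ge0 q; rewrite qQ -scalemxAl sclE q1 mulr1.
have deltaE : delta = \sum_i (degree e i)%:R^-1 * q 0 i ^+ 2.
  by rewrite /delta mul_mx_diag mxE; apply: eq_bigr => i _; rewrite !mxE; ring.
have delta0 : 0 <= delta.
  by rewrite deltaE; apply: sumr_ge0 => i _; rewrite mulr_ge0 ?sqr_ge0 // invr_ge0.
(* Degrees are positive integers, so the entries of [D^-1] are at most 1. *)
have delta1 : delta <= 1.
  rewrite deltaE -[leRHS]q1 mxE; apply: ler_sum => i _.
  rewrite !mxE -expr2; apply: ler_piMl; first exact: sqr_ge0.
  by rewrite invf_le1 ?ltr0n // ler1n.
split=> //; pose x := q *m Di.
have qx : (q *m x^T) 0 0 = delta by rewrite /x trmx_mul tr_diag_mx mulmxA.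
have DiD : Di *m degree_mx R e = 1%:M.
  rewrite mulmx_diag; apply/matrixP=> i j; rewrite !mxE mulVf //.
  by rewrite pnatr_eq0 -lt0n.
have xQx : (x *m Q *m x^T) 0 0 <= 2 * delta.
  have /andP[_ xQx] := signless_laplacian_ge0 R n e x ge; apply: le_trans xQx _.
  by rewrite -[x *m _]mulmxA DiD mulmx1 qx.
clearbody x.
have symQ : Q^T = Q.
  by rewrite /Q linearD /= degree_mx_sym adjacency_mx_sym //; case: ge.
have xQq : (x *m Q *m q^T) 0 0 = mu * delta.
  have -> : x *m Q *m q^T = (q *m Q *m x^T)^T by rewrite !trmx_mul trmxK symQ mulmxA.
  by rewrite mxE qQ -scalemxAl sclE qx.
have : delta * (mu * delta) <= 2 * delta.
  apply: le_trans xQx; rewrite -subr_ge0.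
  have := Q_ge0 (x - delta *: q).
  rewrite !mulmxBl [(_ - _)^T]linearB /= [(_ *: _)^T]linearZ /= -!scalemxAl qQ.
  rewrite !mulmxBr -!scalemxAl -!scalemxAr.
  by rewrite !(subE, sclE) xQq qx q1; lra.
have [->|d0] := eqVneq delta 0; first by rewrite mulr0.
by rewrite [2 * _]mulrC ler_pM2l // lt0r d0.
Qed.

Lemma trace_signless_laplacian_le (R : realType) (n k : nat) (e : rel 'I_n) (X : 'M[R]_n) :
  simple_graph e -> (forall i, (0 < degree e i)%N) ->
  X^T = X -> X *m X = X -> \tr X = k%:R ->
  \tr ((degree_mx R e + adjacency_mx R e) *m X) <= (2 * k + 2 * num_edges e)%:R - n%:R.
Proof.
move=> ge dpos symX XX trX; set Q := _ + _.
have symQ : Q^T = Q.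
  by rewrite /Q linearD /= degree_mx_sym adjacency_mx_sym //; case: ge.
have [P [d PP dQ]] := symmetric_diagonalization R n Q symQ.
have P'P := mulmx1C PP.
have trQM (M : 'M[R]_n) : \tr (Q *m M) = \sum_j d 0 j * (P *m M *m P^T) j j.
  rewrite (orthogonal_conj_diag _ _ _ _ _ PP dQ) -!mulmxA mxtrace_mulC -!mulmxA.
  by rewrite /mxtrace; apply: eq_bigr => j _; rewrite mul_diag_mx mxE mulmxA.
pose Di : 'M[R]_n := diag_mx (\row_i (degree e i)%:R^-1).
(* The rows of [P] are an orthonormal eigenbasis of [Q]; [w] and [delta] are the diagonals of [X]
   and [D^-1] in that basis. *)
pose w j := (P *m X *m P^T) j j; pose delta j := (P *m Di *m P^T) j j.
have w01 j : 0 <= w j <= 1.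
  apply: projection_diag_itv; first by rewrite !trmx_mul trmxK symX mulmxA.
  by rewrite !mulmxA -(mulmxA _ P^T) P'P mulmx1 -(mulmxA _ X X) XX.
have rowPE j (M : 'M[R]_n) : (row j P *m M *m (row j P)^T) 0 0 = (P *m M *m P^T) j j.
  rewrite -row_mul [LHS]mxE [RHS]mxE; apply: eq_bigr => i _.
  by rewrite [row _ _ _ _]mxE [_^T i 0]mxE [_^T i j]mxE [row _ _ _ _]mxE.
have eig j : [/\ 0 <= d 0 j, 0 <= delta j, delta j <= 1 & d 0 j * delta j <= 2].
  rewrite /delta -rowPE; apply: eigenvalue_delta_le => //.
    rewrite -row_mul -[P *m _]mulmx1 -P'P mulmxA dQ row_mul row_diag_mx.
    by rewrite -scalemxAl -rowE.
  by rewrite -[X in X *m _]mulmx1 rowPE mulmx1 PP mxE eqxx.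
have sumw : \sum_j w j = k%:R.
  by rewrite -trX -[X in RHS]mulmx1 -P'P mulmxA mxtrace_mulC mulmxA.
have sumd : \sum_j d 0 j = (2 * num_edges e)%:R.
  have := trQM 1%:M; rewrite mulmx1 [\tr Q]linearD /= trace_degree_mx //.
  rewrite trace_adjacency_mx // addr0 => ->.
  by apply: eq_bigr => j _; rewrite mulmx1 PP mxE eqxx mulr1.
(* This is [tr (Q D^-1)]; the adjacency part has zero diagonal, so every vertex contributes 1. *)
have sumdd : \sum_j d 0 j * delta j = n%:R.
  rewrite -trQM /mxtrace -[in RHS](card_ord n) -sumr_const; apply: eq_bigr => i _.
  rewrite mul_mx_diag mxE [Q i i]mxE adjacency_mx_diag // addr0 !mxE eqxx mulr1n.
  by rewrite divff // pnatr_eq0 -lt0n.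
rewrite trQM natrD natrM -sumw mulr_sumr -sumd -sumdd -big_split -sumrB.
apply: ler_sum => j _ /=; rewrite -/(w j).
have [d0 de0 de1 dde] := eig j; have /andP[w0 w1] := w01 j.
(* The termwise gap [2 w + d - d delta - d w] is the sum of these two nonnegative products. *)
have : 0 <= d 0 j * (1 - delta j) * (1 - w j) by rewrite !mulr_ge0 ?subr_ge0.
have : 0 <= w j * (2 - d 0 j * delta j) by rewrite mulr_ge0 ?subr_ge0.
by lra.
Qed.

(** With [d] a degree and [x] the diagonal entry of [X], [(d - 1) (1 - x) >= 0] gives
    [d x <= x + d - 1]; summing over the vertices finishes. *)
Lemma trace_degree_le (R : realType) (n k : nat) (e : rel 'I_n) (X : 'M[R]_n) :
  simple_graph e -> (forall i, (0 < degree e i)%N) ->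
  X^T = X -> X *m X = X -> \tr X = k%:R ->
  \tr (degree_mx R e *m X) <= (k + 2 * num_edges e)%:R - n%:R.
Proof.
move=> ge dpos symX XX trX.
have -> : (k + 2 * num_edges e)%:R - n%:R =
    \sum_i (X i i + (degree e i)%:R - 1) :> R.
  rewrite sumrB big_split /= -/(\tr X) trX sumr_const card_ord -natr_sum sum_degree //.
  by rewrite natrD.
rewrite trace_degree; apply: ler_sum => i _.
have /andP[x0 x1] := projection_diag_itv _ _ _ i symX XX.
have : 0 <= ((degree e i)%:R - 1) * (1 - X i i).
  by rewrite mulr_ge0 ?subr_ge0 // ler1n.
by lra.
Qed.

(** * From the graph to its spanning tree, and assembly of the bounds *)

Lemma trace_adjacency_subgraph (R : realType) (n : nat) (e t : rel 'I_n) (X : 'M[R]_n) :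
  simple_graph e -> simple_graph t -> subgraph t e ->
  X^T = X -> X *m X = X ->
  \tr (adjacency_mx R e *m X) <=
    \tr (adjacency_mx R t *m X) + (num_edges e)%:R - (num_edges t)%:R.
Proof.
move=> ge gt te symX XX.
have edgesE (f : rel 'I_n) : simple_graph f ->
    (2 * num_edges f)%:R = \sum_i \sum_j (f i j)%:R :> R.
  move=> gf; rewrite -sum_degree // natr_sum; apply: eq_bigr => i _.
  by rewrite degreeE natr_sum.
have trE (f : rel 'I_n) :
    \tr (adjacency_mx R f *m X) = \sum_i \sum_j (f i j)%:R * X i j.
  rewrite trace_adjacency //; apply: eq_bigr => i _; rewrite big_mkcond.
  by apply: eq_bigr => j _; case: (f i j); rewrite ?mul1r ?mul0r.
(* After doubling, edge counts become sums over ordered pairs and the comparison is entrywise. *)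
suff : 2 * \tr (adjacency_mx R e *m X) + (2 * num_edges t)%:R <=
    2 * \tr (adjacency_mx R t *m X) + (2 * num_edges e)%:R.
  by rewrite !natrM; lra.
rewrite !trE !edgesE // !mulr_sumr -!big_split; apply: ler_sum => i _ /=.
rewrite !mulr_sumr -!big_split; apply: ler_sum => j _ /=.
case tij: (t i j); first by rewrite te.
case eij: (e i j) => //; have ij : i != j by apply: contraTneq eij => ->; rewrite ge.2.
have := projection_offdiag_le _ _ _ _ _ symX XX ij.
by rewrite /= !mulr1n !mulr0n; lra.
Qed.

Lemma connected_degree_gt0 (n : nat) (e : rel 'I_n) (i : 'I_n) :
  connected_graph e -> (1 < n)%N -> (0 < degree e i)%N.
Proof.
move=> coe n1; have [j ji] : exists j : 'I_n, j != i.
  have : (0 < #|[set~ i]|)%N by rewrite cardsC1 card_ord; lia.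
  by case/card_gt0P => j; rewrite !inE; exists j.
have /connectP[[|u p] /= + E] := coe i j; first by rewrite E eqxx in ji.
by case/andP => iu _; apply/card_gt0P; exists u; rewrite inE.
Qed.

Lemma connected_trace_signless_laplacian_le (R : realType) (n k : nat)
  (e : rel 'I_n) (X : 'M[R]_n) :
  simple_graph e -> connected_graph e -> (0 < k)%N ->
  X^T = X -> X *m X = X -> \tr X = k%:R ->
  \tr ((degree_mx R e + adjacency_mx R e) *m X) <= (2 * k + 2 * num_edges e)%:R - n%:R.
Proof.
move=> ge coe k0 symX XX trX; have [n1|n1] := ltnP 1 n.
  by apply: trace_signless_laplacian_le => // i; apply: connected_degree_gt0.
have e0 i j : e i j = false.
  have -> : i = j by apply: val_inj => /=; have := ltn_ord i; have := ltn_ord j; lia.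
  by rewrite ge.2.
rewrite mulmxDl linearD /= trace_degree trace_adjacency // !big1 ?addr0.
- by rewrite subr_ge0 ler_nat; lia.
- by move=> i _; rewrite big1 // => j; rewrite e0.
- by move=> i _; rewrite degreeE big1 ?mul0r // => j _; rewrite e0.
Qed.

Theorem theorem4p3 (R : realType) (n : nat) (e t : rel 'I_n) (alpha : R)
  (s : seq R) (k : nat) :
  simple_graph e -> connected_graph e -> spanning_tree e t ->
  eigenvalues_desc (A_alpha e alpha) s ->
  let m := num_edges e in
  let b := matching_number t in
  ((0 <= alpha) && (alpha < 2^-1) ->
     ((1 <= k)%N && (k <= b)%N ->
        S_k s k <= alpha * (n + 2 * k - 2)%:R
                   + (1 - 2 * alpha) * Num.sqrt ((k * (n - 1))%N%:R)
                   + m%:R - n%:R + 1) /\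
     ((b < k)%N && (k <= n - b)%N ->
        S_k s k <= alpha * (n + 2 * k - 2)%:R
                   + (1 - 2 * alpha) * Num.sqrt ((b * (n - 1))%N%:R)
                   + m%:R - n%:R + 1) /\
     ((n - b < k)%N && (k <= n)%N ->
        S_k s k <= alpha * (n + 2 * k - 2)%:R
                   + (1 - 2 * alpha) * Num.sqrt (((n - k) * (n - 1))%N%:R)
                   + m%:R - n%:R + 1)) /\
  ((2^-1 <= alpha) && (alpha < 1) -> (2 <= k)%N && (k <= n)%N ->
     S_k s k <= alpha * ((2 * k + 2 * m)%:R - n%:R)).
Proof.
move=> ge coe [gt [te [cot act]]] specs m b.
have symM : (A_alpha e alpha)^T = A_alpha e alpha.
  rewrite /A_alpha linearD /= !linearZ /= degree_mx_sym adjacency_mx_sym //.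
  by case: ge.
have bn : (b <= n)%N := matching_number_le _ _.
have proj : (k <= n)%N -> exists X : 'M[R]_n,
    [/\ X^T = X, X *m X = X, \tr X = k%:R & S_k s k =
      alpha * \tr (degree_mx R e *m X) + (1 - alpha) * \tr (adjacency_mx R e *m X)].
  move=> /(S_k_projection _ _ _ _ _ symM specs)[X [symX XX trX ->]].
  by exists X; split=> //; rewrite mulmxDl linearD /= -!scalemxAl !linearZ.
split=> [/andP[a0 a1]|/andP[a0 a1] /andP[k2 kn]]; last first.
  have [X [symX XX trX ->]] := proj kn.
  have n1 : (1 < n)%N := leq_trans k2 kn.
  have dpos i := connected_degree_gt0 _ _ i coe n1.
  have a2 : 0 <= 1 - alpha by lra.
  have a3 : 0 <= 2 * alpha - 1 by lra.
  have := ler_wpM2l a2 (trace_signless_laplacian_le R _ _ _ _ ge dpos symX XX trX).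
  have := ler_wpM2l a3 (trace_degree_le R _ _ _ _ ge dpos symX XX trX).
  rewrite mulmxDl linearD /= -/m (natrD _ (2 * k)) (natrD _ k) !(natrM _ 2).
  (* The two weighted bounds add up to [alpha (2 m - n) + k], which falls short of the target by
     exactly this amount. *)
  have : 0 <= (2 * alpha - 1) * k%:R by rewrite mulr_ge0.
  lra.
(* The three cases of part (i) differ only in the bound [r] on the trace over the tree. *)
have bound (r : R) : (0 < k)%N -> (k <= n)%N ->
    (forall X : 'M[R]_n, X^T = X -> X *m X = X -> \tr X = k%:R ->
       \tr (adjacency_mx R t *m X) <= r) ->
    S_k s k <= alpha * (n + 2 * k - 2)%:R + (1 - 2 * alpha) * r + m%:R - n%:R + 1.
  move=> k0 kn Hr; have [X [symX XX trX ->]] := proj kn.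
  have n0 : (0 < n)%N := leq_trans k0 kn.
  have nE : (num_edges t)%:R = n%:R - 1 :> R.
    by rewrite -[in RHS](tree_num_edges _ _ gt cot act n0) -natr1 addrK.
  have a2 : 0 <= 1 - 2 * alpha by lra.
  have := ler_wpM2l a2 (Hr X symX XX trX).
  have := ler_wpM2l a2 (trace_adjacency_subgraph R _ _ _ _ ge gt te symX XX).
  have := ler_wpM2l a0
    (connected_trace_signless_laplacian_le _ _ _ _ _ ge coe k0 symX XX trX).
  (* The natural subtraction in [n + 2 * k - 2] is exact because [0 < k]. *)
  rewrite mulmxDl linearD /= -/m nE natrB; last by lia.
  rewrite (natrD _ n) (natrD _ (2 * k)) !(natrM _ 2).
  lra.
have nE : (0 < k <= n)%N -> num_edges t = (n - 1)%N.
  case/andP => k0 kn; have := tree_num_edges _ _ gt cot act (leq_trans k0 kn); lia.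
have [c cP] := acyclic_bipartite _ _ gt act.
have [C cC covC] := acyclic_vertex_cover _ _ gt act.
split; last split.
- move=> /andP[k0 kb]; have kn := leq_trans kb bn; apply: bound => // X symX XX trX.
  rewrite -nE ?k0 //; apply: le_trans (ler_norm _) _.
  by apply: abs_trace_adjacency_le => //; apply: bipartite_sqr_le cP _ _ _.
- move=> /andP[bk knb]; have kn : (k <= n)%N := leq_trans knb (leq_subr _ _).
  have k0 : (0 < k)%N := leq_ltn_trans (leq0n _) bk.
  apply: bound => // X symX XX trX.
  rewrite -nE ?k0 //; apply: le_trans (ler_norm _) _.
  apply: abs_trace_adjacency_le => //.
  by apply: le_trans (cover_sqr_le _ _ _ _ _ gt covC symX XX) _; rewrite ler_nat.
- move=> /andP[nbk kn]; have k0 : (0 < k)%N := leq_ltn_trans (leq0n _) nbk.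
  apply: bound => // X symX XX trX.
  rewrite -nE ?k0 //; apply: le_trans (ler_norm _) _.
  (* The complementary projection has trace [n - k], and since the adjacency matrix has trace 0,
     passing to it only flips the sign. *)
  pose Y := 1%:M - X.
  have symY : Y^T = Y by rewrite /Y linearB /= trmx1 symX.
  have YY : Y *m Y = Y.
    by rewrite /Y mulmxBl mul1mx mulmxBr mulmx1 XX subrr subr0.
  have trY : \tr Y = (n - k)%:R by rewrite /Y linearB /= mxtrace1 trX natrB.
  have -> : `|\tr (adjacency_mx R t *m X)| = `|\tr (adjacency_mx R t *m Y)|.
    by rewrite /Y mulmxBr mulmx1 linearB /= trace_adjacency_mx // sub0r normrN.
  by apply: abs_trace_adjacency_le => //; apply: bipartite_sqr_le cP _ _ _.
Qed.
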